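(* Let $K$ be a number field whose ring of integers $\mathscr{O}$ is euclidean with respect to a multiplicative norm $\|\cdot\|\colon\mathscr{O}\to\mathbb{Z}^{\ge 0}$, and let $n\geq 1$. As $m$ ranges over $Sp_{2n}(\mathscr{O})$, the classes $[m]$ span $\tilde H_{n-1}(\partial\bar X;\mathbb{Z})$.
   Context: Indices: for an integer $k$ put $\bar k=2n+1-k$, and let $[\![n]\!]^{\pm}=\{1,\dots,n,\bar n,\dots,\bar 1\}$. A nonempty subset $I\subset[\![n]\!]^{\pm}$ is isotropic if $i\neq\bar\jmath$ for all $i,j\in I$. The space $V=K^{2n}$ carries the non-degenerate alternating form $\langle\ ,\ \rangle$ for which the standard basis $e_1,\dots,e_n,e_{\bar n},\dots,e_{\bar 1}$ is symplectic: $\langle e_i,e_j\rangle=1$ if $j=\bar\imath$, $i<j$; $=-1$ if $j=\bar\imath$, $i>j$; $=0$ otherwise (order $1<\dots<n<\bar n<\dots<\bar 1$). $Sp_{2n}(K)$ is the subgroup of $GL_{2n}(K)$ preserving the form, and $Sp_{2n}(\mathscr{O})=Sp_{2n}(K)\cap GL_{2n}(\mathscr{O})$. A subspace of $V$ is isotropic if the form vanishes identically on it. Building: $\mathscr{B}$ is the Tits building of $Sp_{2n}(K)$: the simplicial complex whose vertices are the nonzero isotropic subspaces of $V$ and whose simplices are the flags of such subspaces. Cross-polytope: $\partial\beta_n$ is the first barycentric subdivision of the boundary complex of the cross-polytope with vertices $\pm e_1,\dots,\pm e_n\in\mathbb{R}^n$; writing $e_{\bar\imath}=-e_i$, its vertices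 correspond to isotropic subsets $I\subset[\![n]\!]^{\pm}$ and its simplices to proper flags of isotropic subsets. Its geometric realization is an oriented $(n-1)$-sphere with fundamental class $\xi$ (for $n=1$, the class in reduced $H_0$). Borel-Serre boundary: let $G$ be the $\mathbb{Q}$-group with $G(\mathbb{Q})=Sp_{2n}(K)$ (restriction of scalars), $X$ its symmetric space, $\bar X$ the Borel-Serre partial compactification of $X$, $\partial\bar X$ its boundary. There is a homotopy equivalence $h\colon\mathscr{B}\to\partial\bar X$ compatible with the actions of $G(\mathbb{Q})$ and taking a distinguished apartment $A_0$ homeomorphically onto the boundary $\partial Z$ of the closure $Z$ in $\bar X$ of $A e$. Here $e\in X$ is the basepoint, $A=T(\mathbb{R})^0$ and $T$ is a maximal $\mathbb{Q}$-split torus stable under the Cartan involution at $e$; $A_0$ is the apartment of a symplectic basis of eigenvectors of $T$. Class $[m]$: for $m\in Sp_{2n}(K)$ with columns $v_1,\dots,v_n,v_{\bar n},\dots,v_{\bar 1}$, for every isotropic $I$ the span of $\{v_i:i\in I\}$ is isotropic; let $\phi\colon\partial\beta_n\to\mathscr{B}$ be the simplicial map sending the vertex $I$ to this span, and set $[m]:=h_*\phi_*(\xi)\in\tilde H_{n-1}(\partial\bar X;\mathbb{Z})$. (Via $h_*$, the assertion is equivalent to the statement that the classes $\phi_*(\xi)$, $m\in Sp_{2n}(\mathscr{O})$, span $\tilde H_{n-1}(\mathscr{B};\mathbb{Z})$.) *)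

(* Defs.v *)
From HB Require Import structures.
From mathcomp Require Import all_boot all_order all_algebra all_field.
From mathcomp Require Import boolp.
From mathcomp Require Import freeg.

Set Implicit Arguments.
Unset Strict Implicit.
Unset Printing Implicit Defensive.

Import GRing.Theory.
Local Open Scope ring_scope.
Local Open Scope quotient_scope.

(* Reduced simplicial homology over Z of a complex of flags s_0 < ... < s_d.   *)
(* A simplex is the list of its vertices in increasing order, which orients    *)
(* it; F : pred (seq T) singles out the simplices.  The empty list is the      *)
(* simplex of dimension -1: the boundary in degree 0 is the augmentation, so   *)
(* the homology is the reduced one.                                            *)
Section Homology.
Variable T : choiceType.
Implicit Types (s : seq T) (F : pred (seq T)) (d : nat).

Definition flag (V : pred T) (lt : rel T) : pred (seq T) :=
  [pred s | all V s && pairwise lt s].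

Definition face (i : nat) s : seq T := take i s ++ drop i.+1 s.

Definition boundary : {freeg (seq T) / int} -> {freeg (seq T) / int} :=
  fglift (fun s => \sum_(i < size s) (-1) ^+ i *: << face i s >>).

HB.instance Definition _ :=
  GRing.isZmodMorphism.Build _ _ boundary (lift_is_additive _).

Lemma boundaryU k s :
  boundary << k *g s >> = \sum_(i < size s) << k * (-1) ^+ i *g face i s >>.
Proof.
rewrite /boundary liftU scaler_sumr; apply: eq_bigr => i _.
by apply/eqP/freeg_eqP => t; rewrite !coeffZ !coeffU mul1r mulrA.
Qed.

Definition chain F d : {pred {freeg (seq T) / int}} :=
  [pred c | all (fun s => F s && (size s == d.+1)) (dom c)].

Definition cycle_pred F d : {pred {freeg (seq T) / int}} :=
  [pred c | (c \in chain F d) && (boundary c == 0)].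

Lemma chainP F d c : reflect (forall s, coeff s c != 0 -> F s /\ size s = d.+1)
  (c \in chain F d).
Proof.
apply: (iffP allP) => h s.
  by rewrite -mem_dom => /h /andP[? /eqP ?].
by rewrite mem_dom => /h [-> ->]; rewrite eqxx.
Qed.

Lemma chain_zmod_closed F d : zmod_closed (chain F d).
Proof.
split=> [|c1 c2 /chainP h1 /chainP h2].
  by apply/chainP=> s; rewrite coeff0 eqxx.
apply/chainP=> s; rewrite coeffB.
case: (eqVneq (coeff s c1) 0) => [->|/h1 //].
by rewrite sub0r oppr_eq0 => /h2.
Qed.
HB.instance Definition _ F d :=
  GRing.isZmodClosed.Build _ (chain F d) (chain_zmod_closed F d).

Lemma cycle_zmod_closed F d : zmod_closed (cycle_pred F d).
Proof.
split=> [|c1 c2 /andP[h1 /eqP e1] /andP[h2 /eqP e2]]; apply/andP; split.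
- exact: rpred0.
- by rewrite raddf0.
- exact: rpredB.
- by rewrite raddfB /= e1 e2 subrr.
Qed.
HB.instance Definition _ F d :=
  GRing.isZmodClosed.Build _ (cycle_pred F d) (cycle_zmod_closed F d).

Record cycle F d := Cycle { cycle_val :> {freeg (seq T) / int};
                            cycleP : cycle_val \in cycle_pred F d }.
HB.instance Definition _ F d := [isSub for @cycle_val F d].
HB.instance Definition _ F d := [Choice of cycle F d by <:].
HB.instance Definition _ F d := [SubChoice_isSubZmodule of cycle F d by <:].

Definition boundary_pred F d : {pred cycle F d} :=
  [pred z | `[< exists2 c, c \in chain F d.+1 & cycle_val z = boundary c >]].
Arguments boundary_pred : clear implicits.

Lemma boundary_zmod_closed F d : zmod_closed (boundary_pred F d).
Proof.
split=> [|z1 z2 /asboolP[c1 h1 e1] /asboolP[c2 h2 e2]]; apply/asboolP.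
  by exists 0; [exact: rpred0 | rewrite raddf0].
exists (c1 - c2); first exact: rpredB.
by rewrite raddfB /= -e1 -e2.
Qed.
HB.instance Definition _ F d :=
  GRing.isZmodClosed.Build _ (boundary_pred F d) (boundary_zmod_closed F d).

Definition homology F d : zmodType := Quotient.quot (boundary_pred F d).

Definition homology_class F d (z : cycle F d) : homology F d :=
  \pi_(Quotient.quot (boundary_pred F d)) z.

(* For a triangulated d-sphere: a generator of H_d, i.e. the fundamental class *)
(* of one of the two orientations.                                             *)
Definition fundamental_class F d (xi : homology F d) : Prop :=
  forall x : homology F d, exists k : int, x = xi *~ k.

End Homology.

(* The map induced in homology by a map of vertices that sends the simplices   *)
(* of F to simplices of F' of the same dimension.                              *)
Section InducedMap.
Variables (T T' : choiceType) (F : pred (seq T)) (F' : pred (seq T')).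
Variables (f : T -> T') (fP : forall s, F s -> F' (map f s)).

Definition chain_map : {freeg (seq T) / int} -> {freeg (seq T') / int} :=
  fglift (fun s => << map f s >>).

HB.instance Definition _ :=
  GRing.isZmodMorphism.Build _ _ chain_map (lift_is_additive _).

Lemma chain_mapU k s : chain_map << k *g s >> = << k *g map f s >>.
Proof.
rewrite /chain_map liftU.
by apply/eqP/freeg_eqP => t; rewrite coeffZ !coeffU mul1r.
Qed.

Lemma chain_map_boundary c : boundary (chain_map c) = chain_map (boundary c).
Proof.
rewrite -[c]freeg_sumE !raddf_sum; apply: eq_bigr => s _ /=.
rewrite chain_mapU !boundaryU raddf_sum size_map; apply: eq_bigr => i _ /=.
by rewrite chain_mapU /face map_cat map_take map_drop.
Qed.

Lemma chain_map_chain d c : c \in chain F d -> chain_map c \in chain F' d.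
Proof.
move=> /chainP h; rewrite -[c]freeg_sumE raddf_sum big_seq.
apply: rpred_sum => s; rewrite mem_dom => /h[Fs ss].
rewrite /= chain_mapU; apply/chainP => t; rewrite coeffU.
case: (map f s =P t) => [<- _|_]; last by rewrite mulr0 eqxx.
by rewrite size_map; split; first exact: fP.
Qed.

Lemma cycle_map_subproof d (z : cycle F d) : chain_map z \in cycle_pred F' d.
Proof.
have /andP[zC /eqP z0] := cycleP z.
by rewrite inE chain_map_chain //= chain_map_boundary z0 raddf0.
Qed.

Definition cycle_map d (z : cycle F d) : cycle F' d :=
  Cycle (cycle_map_subproof z).

Definition homology_map d (x : homology F d) : homology F' d :=
  homology_class (cycle_map (repr x)).

Lemma homology_map_class d (z : cycle F d) :
  homology_map (homology_class z) = homology_class (cycle_map z).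
Proof.
rewrite /homology_map /homology_class; apply/eqP.
case: piP => y /eqP; rewrite -!Quotient.idealrBE => /asboolP[c cC e]; apply/asboolP.
exists (- chain_map c); first by rewrite rpredN chain_map_chain.
by rewrite raddfN /= chain_map_boundary -e (raddfB chain_map) opprB.
Qed.

End InducedMap.

Section Span.
Variable H : zmodType.

Definition spans (S : H -> Prop) : Prop :=
  forall z : H, exists r (c : 'I_r -> int) (x : 'I_r -> H),
    (forall i, S (x i)) /\ z = \sum_(i < r) x i *~ c i.

End Span.

(* The indices 1 < ... < n < \bar n < ... < \bar 1 are 'I_n.*2 in its usual     *)
(* order, shifted by one: i : 'I_n.*2 stands for i + 1, and k |-> 2n + 1 - k   *)
(* is rev_ord.                                                                 *)
Section CrossPolytope.
Variable n : nat.

Definition bar (i : 'I_n.*2) : 'I_n.*2 := rev_ord i.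

Definition isotropic_set (I : {set 'I_n.*2}) : bool :=
  (I != set0) && [forall i in I, forall j in I, i != bar j].

Definition cross_polytope : pred (seq {set 'I_n.*2}) :=
  flag isotropic_set (fun I J => I \proper J).

End CrossPolytope.

Section Symplectic.
Variables (K : fieldType) (n : nat).
Implicit Types (u v : 'cV[K]_n.*2) (m : 'M[K]_n.*2) (U : {vspace 'cV[K]_n.*2}).

Definition gram : 'M[K]_n.*2 :=
  \matrix_(i, j) (if j == bar i then (if (i < j)%N then 1 else -1) else 0).

Definition form u v : K := (u^T *m gram *m v) 0 0.

Definition isotropic_space U : Prop := {in U &, forall u v, form u v = 0}.

Definition building : pred (seq {vspace 'cV[K]_n.*2}) :=
  flag (fun U => (U != 0%VS) && `[< isotropic_space U >])
       (fun U W => (U <= W)%VS && (U != W)).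

Definition symplectic m : Prop :=
  m \in unitmx /\ forall u v, form (m *m u) (m *m v) = form u v.

Definition Sp := {m : 'M[K]_n.*2 | symplectic m}.

(* the vertex map of phi *)
Definition column_span m (I : {set 'I_n.*2}) : {vspace 'cV[K]_n.*2} :=
  <<[seq col i m | i <- enum I]>>%VS.

Lemma span_sub (P : 'cV[K]_n.*2 -> Prop) (s : seq 'cV[K]_n.*2) :
    P 0 -> (forall a u v, P u -> P v -> P (a *: u + v)) ->
    {in s, forall u, P u} -> {in <<s>>%VS, forall u, P u}.
Proof.
move=> P0 PD Ps u; rewrite -[s]/(val (in_tuple s)) => /coord_span ->.
apply: (big_ind P) => // [x y Px Py|i _].
  by rewrite -[x]scale1r; apply: PD.
by rewrite -[_ *: _]addr0; apply: PD => //; apply: Ps; rewrite mem_nth.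
Qed.

Lemma form_linl a u v w : form (a *: u + v) w = a * form u w + form v w.
Proof. by rewrite /form linearP !mulmxDl -!scalemxAl !mxE. Qed.

Lemma form_linr a u v w : form w (a *: u + v) = a * form w u + form w v.
Proof. by rewrite /form mulmxDr -scalemxAr !mxE. Qed.

Lemma form_delta i j : form (delta_mx i 0) (delta_mx j 0) = gram i j.
Proof. by rewrite /form trmx_delta -rowE -colE !mxE. Qed.

Lemma column_span_isotropic m I : symplectic m ->
  isotropic_set I -> isotropic_space (column_span m I).
Proof.
move=> [_ mP] /andP[_ /forall_inP hI] u v uI vI; move: u uI v vI.
apply: span_sub => [v _|a u u' hu hu' v vI|_ /mapP[i + ->]].
- by rewrite /form linear0 !mul0mx mxE.
- by rewrite form_linl hu // hu' // mulr0 addr0.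
rewrite mem_enum => iI.
apply: span_sub => [|a v v' hv hv'|_ /mapP[j + ->]].
- by rewrite /form mulmx0 mxE.
- by rewrite form_linr hv hv' mulr0 addr0.
rewrite mem_enum => jI; rewrite !colE mP form_delta mxE.
by have /forall_inP/(_ _ iI)/negPf -> := hI _ jI.
Qed.

Lemma mem_column_span m I j : m \in unitmx ->
  (col j m \in column_span m I) = (j \in I).
Proof.
move=> mU; apply/idP/idP => [|jI]; last first.
  by apply: memv_span; apply: map_f; rewrite mem_enum.
apply: contraLR => jI; apply/negP => h.
have key : {in column_span m I, forall u, (invmx m *m u) j 0 = 0}.
  apply: span_sub => [|a u v hu hv|_ /mapP[i + ->]].
  - by rewrite mulmx0 mxE.
  - by rewrite mulmxDr -scalemxAr mxE hv addr0 mxE hu mulr0.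
  rewrite mem_enum => iI; rewrite colE mulmxA mulVmx // mul1mx mxE eqxx andbT.
  by case: eqP => // ji; rewrite ji iI in jI.
have := key _ h; rewrite colE mulmxA mulVmx // mul1mx mxE !eqxx => /eqP.
by rewrite oner_eq0.
Qed.

Lemma column_span_flag m (s : seq {set 'I_n.*2}) : symplectic m ->
  cross_polytope s -> building (map (column_span m) s).
Proof.
move=> mS; have [mU _] := mS.
move=> /andP[/allP sV sP]; apply/andP; split.
  apply/allP => _ /mapP[I /sV Iiso ->] /=; apply/andP; split; last first.
    by apply/asboolP; apply: column_span_isotropic.
  have /andP[/set0Pn[i iI] _] := Iiso; apply/negP => /eqP U0.
  move: iI; rewrite -(mem_column_span _ _ mU) U0 memv0 => /eqP c0.
  have := mem_column_span set0 i mU; rewrite c0 mem0v inE.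
  by [].
rewrite pairwise_map; apply: sub_pairwise sP => I J /properP[sIJ [j jJ jI]] /=.
apply/andP; split.
  apply/span_subvP => _ /mapP[i + ->]; rewrite mem_enum => iI.
  by rewrite mem_column_span // (subsetP sIJ).
by apply: contraNneq jI => e; rewrite -(mem_column_span _ _ mU) e mem_column_span.
Qed.

(* phi_* (xi) *)
Definition apartment_class d (xi : homology (@cross_polytope n) d) (m : Sp) :
    homology building d :=
  homology_map (fun s => column_span_flag (s := s) (svalP m)) xi.

(* The class [m] = h_* phi_* (xi).  The homotopy equivalence h from the        *)
(* building to the boundary of the Borel-Serre partial compactification enters *)
(* only through the isomorphism h_* from the homology of the building to the   *)
(* group H, the reduced homology of that boundary.                             *)
Definition modular_symbol d (H : zmodType) (h_ : homology building d -> H)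
  (xi : homology (@cross_polytope n) d) (m : Sp) : H := h_ (apartment_class xi m).

End Symplectic.

Section Integers.
Variable K : fieldExtType rat.

Definition integer (x : K) : Prop := integralOver (intmul 1 : int -> K) x.

(* N is only constrained on integers, i.e. it is a function from the ring of   *)
(* integers to the natural numbers.                                            *)
Definition multiplicative_euclidean_norm (N : K -> nat) : Prop :=
  [/\ forall x, integer x -> (N x = 0%N <-> x = 0),
      forall x y, integer x -> integer y -> N (x * y) = (N x * N y)%N
    & forall a b, integer a -> integer b -> b != 0 ->
        exists q r, [/\ integer q, integer r, a = q * b + r & (N r < N b)%N]].

Definition integer_mx p (m : 'M[K]_p) : Prop := forall i j, integer (m i j).

Definition in_SpO n (m : Sp K n) : Prop :=
  integer_mx (sval m) /\ integer_mx (invmx (sval m)).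

End Integers.

(* Main.v *)
From HB Require Import structures.
From mathcomp Require Import all_boot all_order all_algebra all_field.
From mathcomp Require Import boolp freeg zify ring.
Require Import Defs.

Set Implicit Arguments.
Unset Strict Implicit.
Unset Printing Implicit Defensive.

Import GRing.Theory.
Local Open Scope ring_scope.

(** The apartment classes of integral symplectic bases span the top homology of
the building, by an induction on the rank that proves the Solomon-Tits theorem
and runs the Euclidean algorithm at the same time.

For an isotropic space U spanned by part of an integral symplectic basis, the
link of U is the complex of flags of isotropic spaces strictly above U; it is
the building of U^perp / U.  The claim ([integral_apartments_span]) is that every
top-dimensional cycle z in this link is an integral combination of apartments of
integral symplectic bases extending the given basis of U.  Group the flags of z
by their lowest space L, so that z is the sum of the cones L * z_L.  Because the
boundary of z vanishes, each z_L is a cycle in the link of L and the z_L sum to 0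
([link_part_cycle]).  By transitivity of the integral symplectic group,
L = U + <v> where v belongs to an integral symplectic basis extending that of U
([covers_integral_basis]), so by induction z_L is a combination of apartments of
integral bases containing v.

Fix a vector e of the given integral basis, orthogonal to U and not in U, and
measure L by the norm of <e, v>.  If <e, v> is not 0, an integral symplectic
transvection fixing v and the basis of U adds multiples of v to the other basis
vectors x and compensates on the partner of v; by Euclidean division all the norms
of <e, x> become smaller than the norm of <e, v>, the partner being treated last.
The flags containing v do not see this change
([transvection_descent]).  The apartment of the new basis has the same part as
before at L, and all its other lowest spaces have smaller measure.  Subtracting
such apartments lowers the measures occurring in z ([reduce_apartment]), until all
lowest spaces of z are orthogonal to e.  But then z = 0
([cycle_orthogonal_eq0]): e cannot be added to a Lagrangian space, so the cycles
z_L with e not in L vanish by induction on the rank, and the only other possible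
lowest space is U + <e>, whose z_L vanishes because the z_L sum to 0.

For U = 0 the apartments are the images of one explicit cycle of the
cross-polytope, the alternating sum of all maximal flags of isotropic sets
([cross_cycle]).  Its class is a multiple of the fundamental class, and this is
enough for spanning. *)

(** * Cones, links and supports of flag chains *)

Section Cones.
Variable T : choiceType.
Implicit Types (s t : seq T) (x y : T) (z : {freeg (seq T) / int}).

Definition join_vertex x : {freeg (seq T) / int} -> {freeg (seq T) / int} :=
  fglift (fun s => << x :: s >>).
HB.instance Definition _ x :=
  GRing.isZmodMorphism.Build _ _ (join_vertex x) (lift_is_additive _).

(** The coefficient of the cone over [x]: the chain of the flags [t] such that
[x :: t] occurs in the argument. *)
Definition link_part x : {freeg (seq T) / int} -> {freeg (seq T) / int} :=
  fglift (fun s => if s is y :: t then if y == x then << t >> else 0 else 0).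
HB.instance Definition _ x :=
  GRing.isZmodMorphism.Build _ _ (link_part x) (lift_is_additive _).

Lemma freegU_scale (k : int) s : << k *g s >> = k *: << s >> :> {freeg (seq T) / int}.
Proof. by apply/eqP/freeg_eqP => t; rewrite coeffZ !coeffU mul1r. Qed.

Lemma join_vertexU x k s : join_vertex x << k *g s >> = << k *g x :: s >>.
Proof. by rewrite /join_vertex liftU [RHS]freegU_scale. Qed.

Lemma freeg_decomp z : z = \sum_(s <- dom z) << coeff s z *g s >>.
Proof. by rewrite freeg_sumE. Qed.

Lemma coeff_link_part x s z : coeff s (link_part x z) = coeff (x :: s) z.
Proof.
rewrite {1}[z]freeg_decomp [z in RHS]freeg_decomp !raddf_sum.
apply: eq_bigr => -[|y t] _ /=; rewrite /link_part liftU coeffU.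
  by rewrite scaler0 coeff0 mulr0.
by rewrite eqseq_cons; case: eqP => _; rewrite coeffZ ?coeffU ?coeff0 ?mul1r.
Qed.

Lemma coeff_join_vertex x y s z :
  coeff (y :: s) (join_vertex x z) = if x == y then coeff s z else 0.
Proof.
rewrite {1}[z]freeg_decomp [z in RHS]freeg_decomp !raddf_sum /=.
case: eqP => [->|xy].
  apply: eq_bigr => t _; rewrite /= join_vertexU.
  by rewrite !coeffU eqseq_cons eqxx.
rewrite big1 // => t _; rewrite /= join_vertexU coeffU eqseq_cons.
by case: eqP xy => //; rewrite mulr0.
Qed.

Lemma coeff_join_vertex_nil x z : coeff [::] (join_vertex x z) = 0.
Proof.
rewrite [z]freeg_decomp !raddf_sum big1 // => t _.
by rewrite /= join_vertexU coeffU mulr0.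
Qed.

Lemma boundary_nil k : boundary (<< k *g [::] >> : {freeg (seq T) / int}) = 0.
Proof. by rewrite boundaryU big_ord0. Qed.

(** The face opposite to the new lowest vertex is the base of the cone. *)
Lemma boundary_join_vertex x z :
  boundary (join_vertex x z) = z - join_vertex x (boundary z).
Proof.
rewrite [z]freeg_decomp !raddf_sum /= -big_split /=; apply: eq_bigr => s _.
rewrite join_vertexU !boundaryU /= big_ord_recl /= expr0 mulr1.
rewrite /face take0 /= drop0; congr (_ + _).
rewrite raddf_sum -sumrN; apply: eq_bigr => i _ /=.
by rewrite join_vertexU exprS mulN1r mulrN freegUN.
Qed.

Lemma link_part_join_vertex x y z :
  link_part x (join_vertex y z) = if y == x then z else 0.
Proof.
apply/eqP/freeg_eqP => s; rewrite coeff_link_part coeff_join_vertex.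
by case: eqP => //; rewrite coeff0.
Qed.

Definition supported (P : seq T -> Prop) z := forall s, coeff s z != 0 -> P s.

Lemma supported0 P : supported P 0.
Proof. by move=> s; rewrite coeff0 eqxx. Qed.

Lemma supportedD P z z' :
  supported P z -> supported P z' -> supported P (z + z').
Proof.
move=> h h' s; rewrite coeffD; case: (eqVneq (coeff s z) 0) => [->|/h //].
by rewrite add0r => /h'.
Qed.

Lemma supportedN P z : supported P z -> supported P (- z).
Proof. by move=> h s; rewrite coeffN oppr_eq0 => /h. Qed.

Lemma supportedMz P z k : supported P z -> supported P (z *~ k).
Proof. by move=> h s; rewrite raddfMz mulrz_eq0 negb_or => /andP[_ /h]. Qed.

Lemma supported_sum P (I : Type) (r : seq I) (Q : pred I) F :
  (forall i, Q i -> supported P (F i)) -> supported P (\sum_(i <- r | Q i) F i).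
Proof.
by move=> h; apply: big_rec => [|i z Qi hz]; [apply: supported0|apply: supportedD => //; apply: h].
Qed.

Lemma supported_sub (P Q : seq T -> Prop) z :
  (forall s, P s -> Q s) -> supported P z -> supported Q z.
Proof. by move=> h hz s /hz /h. Qed.

Lemma supported_join (P : seq T -> Prop) x z :
  supported (fun s => P (x :: s)) z -> supported P (join_vertex x z).
Proof.
move=> h [|y s]; first by rewrite coeff_join_vertex_nil eqxx.
by rewrite coeff_join_vertex; case: (x =P y) => [<- /h|_] //; rewrite eqxx.
Qed.

Definition lowest_vertices z := undup (flatten [seq take 1 s | s <- dom z]).

Lemma mem_lowest_vertices x s z : coeff (x :: s) z != 0 -> x \in lowest_vertices z.
Proof.
move=> h; rewrite mem_undup; apply/flatten_mapP; exists (x :: s).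
  by rewrite mem_dom.
by rewrite /= mem_head.
Qed.

Lemma lowest_vertices_mem x z : x \in lowest_vertices z -> exists s, coeff (x :: s) z != 0.
Proof.
rewrite mem_undup => /flatten_mapP[[|y s]] //; rewrite mem_dom => h.
by rewrite /= take0 inE => /eqP ->; exists s.
Qed.

Lemma join_link_decomp r z : supported (fun s => size s = r.+1) z ->
  z = \sum_(x <- lowest_vertices z) join_vertex x (link_part x z).
Proof.
move=> hz; apply/eqP/freeg_eqP => -[|y s].
  rewrite raddf_sum big1 => [|x _]; last by rewrite /= coeff_join_vertex_nil.
  by apply/eqP; apply/negPn/negP => /hz.
rewrite raddf_sum /=.
under eq_bigr do rewrite coeff_join_vertex coeff_link_part.
have [yz|yz] := boolP (y \in lowest_vertices z); last first.
  rewrite big1_seq => [|x /= xz]; last by case: eqP => // e; rewrite -e xz in yz.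
  by apply/eqP; apply: contraNT yz => /mem_lowest_vertices.
rewrite (bigD1_seq y) ?undup_uniq //= eqxx big1 ?addr0 // => x /negPf.
by move=> ->.
Qed.

(** Both sides are parts of the boundary of [z], in which the faces that lose
their lowest vertex are separated from those that keep it. *)
Lemma cycle_sum_link r z : supported (fun s => size s = r.+1) z ->
  boundary z = 0 ->
  \sum_(x <- lowest_vertices z) link_part x z
    = \sum_(x <- lowest_vertices z) join_vertex x (boundary (link_part x z)).
Proof.
move=> /join_link_decomp hz; rewrite {1}hz raddf_sum /= => z0.
apply/subr0_eq; rewrite -sumrB -[RHS]z0.
by apply: eq_bigr => x _; rewrite /= boundary_join_vertex.
Qed.

(** When flags are graded by dimension the right-hand side vanishes, since no
flag above [x] starts at the level of [x]; links of cycles are then cycles. *)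
Lemma boundary_link_part r z x : supported (fun s => size s = r.+1) z ->
  boundary z = 0 -> x \in lowest_vertices z ->
  boundary (link_part x z) = \sum_(y <- lowest_vertices z) link_part x (link_part y z).
Proof.
move=> hz z0 xz; have e := cycle_sum_link hz z0.
have := congr1 (link_part x) e; rewrite !raddf_sum => -> /=.
rewrite (bigD1_seq x) ?undup_uniq //= link_part_join_vertex eqxx.
by rewrite big1 ?addr0 // => y /negPf yx; rewrite link_part_join_vertex yx.
Qed.

Lemma coeff_sum_link_eq0 s z x : x \in lowest_vertices z ->
  \sum_(y <- lowest_vertices z) link_part y z = 0 ->
  {in lowest_vertices z, forall y, y != x -> coeff (y :: s) z = 0} ->
  coeff (x :: s) z = 0.
Proof.
move=> xz sum0 hz; have := congr1 (coeff s) sum0.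
rewrite raddf_sum coeff0 /= (bigD1_seq x) ?undup_uniq //= coeff_link_part.
rewrite big1_seq ?addr0 // => y /andP[yx yz].
by rewrite coeff_link_part hz.
Qed.

End Cones.

Section IntSpan.
Variable M : zmodType.
Implicit Types (S : M -> Prop) (x y : M).

Inductive int_span S : M -> Prop :=
| int_span0 : int_span S 0
| int_span_step k x y : S x -> int_span S y -> int_span S (x *~ k + y).

Lemma int_spanD S x y : int_span S x -> int_span S y -> int_span S (x + y).
Proof.
move=> + hy; elim=> [|k u v Su _ IH]; first by rewrite add0r.
by rewrite -addrA; apply: int_span_step.
Qed.

Lemma int_spanMz S k x : int_span S x -> int_span S (x *~ k).
Proof.
elim=> [|c u v Su _ IH]; first by rewrite mul0rz; apply: int_span0.
by rewrite mulrzDl -mulrzA; apply: int_span_step.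
Qed.

Lemma int_span_gen S x : S x -> int_span S x.
Proof.
move=> Sx; rewrite -[x]addr0 -[x]mulr1z.
by apply: int_span_step => //; apply: int_span0.
Qed.

Lemma int_span_spans S : (forall x, int_span S x) -> spans S.
Proof.
move=> h z; elim: {z}(h z) => [|k x y Sx _ [r [c [X [XS ->]]]]].
  by exists 0%N, (fun _ => 0), (fun _ => 0); split=> [[]//|]; rewrite big_ord0.
exists r.+1, (oapp c k \o unlift ord0), (oapp X x \o unlift ord0); split=> [i|].
  by rewrite /=; case: unliftP => [j|] _ //=.
rewrite big_ord_recl /= unlift_none /=; congr (_ + _).
by apply: eq_bigr => i _; rewrite liftK.
Qed.

End IntSpan.

(** * The cycle of the cross-polytope *)

(** Chains have no 2-torsion, so a sum that an involution of its terms turns into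
its opposite vanishes. *)
Lemma freeg_eq_opp0 (T : choiceType) (z : {freeg T / int}) : z = - z -> z = 0.
Proof.
move=> zN; apply/eqP/freeg_eqP => s; rewrite coeff0.
by have /eqP := congr1 (coeff s) zN; rewrite coeffN; lia.
Qed.

Section CrossPolytopeCycle.
Variable n : nat.
Implicit Types (i j : 'I_n.*2) (I J : {set 'I_n.*2}).

Lemma barK : involutive (@bar n).
Proof. exact: rev_ordK. Qed.

Lemma bar_neq i : bar i != i.
Proof. by rewrite -val_eqE /=; have := ltn_ord i; lia. Qed.

Lemma ltn_bar i j : (bar i < bar j)%N = (j < i)%N.
Proof. by rewrite /=; have := ltn_ord i; have := ltn_ord j; lia. Qed.

Lemma eq_bar i j : (bar i == j) = (i == bar j).
Proof. by apply/eqP/eqP => [<-|->]; rewrite barK. Qed.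

(** Isotropic or empty: the form in which a partial flag can be extended from
the empty set. *)
Definition polar_free I := [forall i in I, bar i \notin I].

Lemma polar_freeP I : reflect {in I, forall i, bar i \notin I} (polar_free I).
Proof. exact: forall_inP. Qed.

Lemma polar_free0 : polar_free set0.
Proof. by apply/polar_freeP => i; rewrite inE. Qed.

Lemma isotropic_setE I : isotropic_set I = (I != set0) && polar_free I.
Proof.
congr andb; apply/forall_inP/forall_inP => h i iI.
  by apply/negP => /(forall_inP (h i iI)); rewrite barK eqxx.
by apply/forall_inP => j /h; apply: contraNneq => <-.
Qed.

Definition free_indices I := [set i | (i \notin I) && (bar i \notin I)].

Lemma free_bar I i : (bar i \in free_indices I) = (i \in free_indices I).
Proof. by rewrite !inE barK andbC. Qed.

Lemma free_indicesU I i j : (j \in free_indices (i |: I))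
  = [&& j \in free_indices I, j != i & j != bar i].
Proof.
by rewrite !inE !negb_or eq_bar; case: (j != i); case: (j != bar i);
  rewrite ?andbT ?andbF.
Qed.

Lemma polar_freeU I i :
  polar_free I -> i \in free_indices I -> polar_free (i |: I).
Proof.
move=> /polar_freeP hI; rewrite inE => /andP[iI biI]; apply/polar_freeP => j.
rewrite !inE negb_or => /orP[/eqP ->|jI]; first by rewrite bar_neq.
by rewrite hI // andbT; apply: contraNneq biI => <-; rewrite barK.
Qed.

Lemma card_free_indices I :
  polar_free I -> #|free_indices I| = (n.*2 - #|I|.*2)%N.
Proof.
move=> /polar_freeP hI; have -> : free_indices I = ~: (I :|: @bar n @: I).
  apply/setP => i; rewrite !inE negb_or; congr (_ && ~~ _).
  by apply/idP/imsetP => [|[j jI ->]]; [exists (bar i); rewrite ?barK | rewrite barK].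
rewrite cardsCs setCK card_ord cardsU (card_imset _ (inv_inj barK)) addnn.
suff -> : I :&: @bar n @: I = set0 by rewrite cards0 subn0.
apply/setP => i; rewrite !inE; apply/negP => /andP[iI /imsetP[j /hI + e]].
by rewrite -e iI.
Qed.

Definition rank_below I i := (\sum_(j in free_indices I) (j < i))%N.

(** The involution [bar] reverses the order, so it exchanges the free indices
below [bar i] with those above [i]. *)
Lemma rank_below_bar I i : i \in free_indices I ->
  (rank_below I i + rank_below I (bar i)).+1 = #|free_indices I|.
Proof.
move=> iI; rewrite /rank_below [X in (_ + X)%N](reindex_inj (inv_inj barK)) /=.
under [X in (_ + X)%N]eq_bigl do rewrite free_bar.
rewrite -big_split /= -sum1_card (bigD1 i) //= [RHS](bigD1 i) //= ltn_bar ltnn.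
rewrite !add0n add1n; congr _.+1; apply: eq_bigr => j /andP[_ ji].
by rewrite ltn_bar; move: ji; rewrite -val_eqE /=; case: ltngtP.
Qed.

Lemma rank_belowU I i j : i \in free_indices I ->
  rank_below I j = (rank_below (i |: I) j + (i < j) + (bar i < j))%N.
Proof.
move=> iI; rewrite /rank_below (bigD1 i) //= (bigD1 (bar i)) /=; last first.
  by rewrite free_bar iI bar_neq.
rewrite addnA addnC addnA; congr (_ + _ + _)%N; apply: eq_bigl => k.
by rewrite free_indicesU -andbA.
Qed.

(** The product of these signs along a maximal flag is the determinant of the
signed permutation that lists the indices added by the flag: counting the free
indices below [i] in the order 1 < ... < n < bar n < ... < bar 1 records at once
the inversions of [i] and, by parity, whether [i] is barred. *)
Definition index_sign I i : int := (-1) ^+ rank_below I i.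

Lemma index_sign_bar I i : polar_free I -> i \in free_indices I ->
  index_sign I (bar i) = - index_sign I i.
Proof.
move=> hI iI; rewrite /index_sign -signr_odd -[in RHS]signr_odd -signrN.
congr (_ ^+ _); have := rank_below_bar iI; rewrite card_free_indices //.
rewrite -doubleB => /(congr1 odd); rewrite odd_double /= oddD.
by case: odd; case: odd.
Qed.

Lemma index_sign_swap I i j :
  i \in free_indices I -> j \in free_indices (i |: I) ->
  index_sign I i * index_sign (i |: I) j
    = - (index_sign I j * index_sign (j |: I) i).
Proof.
move=> iI; rewrite free_indicesU => /and3P[jI ji _].
rewrite /index_sign -!exprD -signr_odd -[in RHS]signr_odd -signrN; congr (_ ^+ _).
rewrite (rank_belowU j iI) (rank_belowU i jI).
have -> : (bar j < i)%N = (bar i < j)%N by rewrite -{1}(barK i) ltn_bar.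
move: ji; rewrite -val_eqE /=.
by case: ltngtP => //= _ _; rewrite !oddD /=; do 4!case: odd => //=; case: (_ < _)%N.
Qed.

(** The alternating sum of the maximal flags above [I], adding one free index at
a time; [r] is the number of pairs of opposite indices still free. *)
Fixpoint cross_cycle r I : {freeg (seq {set 'I_n.*2}) / int} :=
  if r is r'.+1 then
    \sum_(i in free_indices I)
      join_vertex (i |: I) (cross_cycle r' (i |: I)) *~ index_sign I i
  else << [::] >>.

(** A codimension one face is contained in exactly two flags of the sum, with
opposite signs: the two orders of adding a pair of indices ([index_sign_swap]),
or, at the top of the flag, an index and its opposite ([index_sign_bar]). *)
Lemma boundary_cross_cycle r I : polar_free I -> (#|I| + r)%N = n ->
  boundary (cross_cycle r I) = 0.
Proof.
elim: r I => [|r IH] I hI cI /=; first exact: boundary_nil.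
rewrite raddf_sum /=.
transitivity (\sum_(i in free_indices I)
  cross_cycle r (i |: I) *~ index_sign I i).
  apply: eq_bigr => i iI; rewrite raddfMz /= boundary_join_vertex IH.
  - by rewrite raddf0 subr0.
  - exact: polar_freeU.
  - move: iI; rewrite inE cardsU1 => /andP[-> _].
    by rewrite [RHS](esym cI) add1n addSnnS.
apply: freeg_eq_opp0; rewrite -sumrN; case: r {IH} cI => [|r] cI.
  rewrite (reindex_inj (inv_inj barK)) /=; under eq_bigl do rewrite free_bar.
  by apply: eq_bigr => i iI; rewrite index_sign_bar //= mulrNz.
(* Antisymmetric in i and j. *)
pose F i j := join_vertex (j |: (i |: I)) (cross_cycle r (j |: (i |: I)))
  *~ (index_sign I i * index_sign (i |: I) j).
transitivity (\sum_(i in free_indices I) \sum_(j in free_indices (i |: I)) F i j).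
  apply: eq_bigr => i iI; rewrite /= mulrz_suml; apply: eq_bigr => j _.
  by rewrite -mulrzA mulrC.
rewrite (exchange_big_dep (mem (free_indices I))) /=; last first.
  by move=> i j _; rewrite free_indicesU => /andP[].
apply: eq_bigr => j jI; rewrite mulrz_suml -sumrN; apply: eq_big => i.
  rewrite !free_indicesU jI /= [j == i]eq_sym [j == bar i]eq_sym eq_bar.
  by [].
move=> /andP[iI ji]; rewrite /F -mulrzA -mulrNz [j |: _]setUCA.
by rewrite (index_sign_swap iI ji) [X in - X]mulrC.
Qed.

End CrossPolytopeCycle.

(** * Symplectic bases and isotropic spaces *)

Section SymplecticBases.
Variables (K : fieldType) (n : nat).
Local Notation V := 'cV[K]_n.*2.
Implicit Types (u v w x y a : V) (m : 'M[K]_n.*2) (U W : {vspace V}).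
Implicit Types (i j : 'I_n.*2) (I J : {set 'I_n.*2}).

Lemma gram_neq i j : j != bar i -> gram K n i j = 0.
Proof. by rewrite mxE => /negPf ->. Qed.

Lemma gramN i j : gram K n j i = - gram K n i j.
Proof.
rewrite !mxE -eq_bar eq_sym; case: eqP => [->|]; last by rewrite oppr0.
have := bar_neq i; rewrite -(inj_eq val_inj).
by case: (ltngtP (bar i) i) => // _ _; rewrite ?opprK.
Qed.

Lemma gram_bar_sq i : gram K n i (bar i) * gram K n i (bar i) = 1.
Proof. by rewrite mxE eqxx; case: ifP; rewrite ?mulrNN mulr1. Qed.

Lemma gram_unitmx : gram K n \in unitmx.
Proof.
suff e : gram K n *m (- gram K n) = 1%:M by case/mulmx1_unit: e.
apply/matrixP => i j; rewrite mxE (bigD1 (bar i)) //= big1 => [|k ki]; last first.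
  by rewrite gram_neq ?mul0r.
rewrite addr0 [X in _ * X]mxE -gramN [RHS]mxE; have [->|ij] := eqVneq i j; first exact: gram_bar_sq.
rewrite [X in _ * X]gram_neq ?mulr0 //; apply: contraNneq ij.
by move=> /(inv_inj (@barK n)) ->.
Qed.

Lemma formE u v :
  form u v = \sum_i u i 0 * (gram K n i (bar i) * v (bar i) 0).
Proof.
rewrite /form -mulmxA mxE; apply: eq_bigr => i _.
rewrite [u^T _ _]mxE [(_ *m v) _ _]mxE; congr (_ * _).
by rewrite (bigD1 (bar i)) //= big1 ?addr0 // => j /gram_neq ->; rewrite mul0r.
Qed.

Lemma form_skew u v : form v u = - form u v.
Proof.
rewrite !formE (reindex_inj (inv_inj (@barK n))) -sumrN; apply: eq_bigr => i _.
by rewrite barK [gram K n (bar i) i]gramN; ring.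
Qed.

(** The terms at [i] and [bar i] cancel, which also covers characteristic 2. *)
Lemma form_alternating v : form v v = 0.
Proof.
rewrite formE (bigID (fun i => i < bar i)%N) /= [X in _ + X](reindex_inj (inv_inj (@barK n))).
apply/eqP; rewrite addr_eq0 -sumrN; apply/eqP; apply: eq_big => [i|i _].
  by rewrite /=; have := ltn_ord i; lia.
rewrite barK [gram K n (bar i) i]gramN. ring.
Qed.

Lemma formDr w u v : form w (u + v) = form w u + form w v.
Proof. by rewrite -{1}[u]scale1r form_linr mul1r. Qed.
Lemma formDl w u v : form (u + v) w = form u w + form v w.
Proof. by rewrite -{1}[u]scale1r form_linl mul1r. Qed.
Lemma form0r w : form w 0 = 0. Proof. by rewrite /form mulmx0 mxE. Qed.
Lemma form0l w : form 0 w = 0. Proof. by rewrite /form linear0 !mul0mx mxE. Qed.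
Lemma formZr w c u : form w (c *: u) = c * form w u.
Proof. by rewrite -[c *: u]addr0 form_linr form0r addr0. Qed.
Lemma formZl w c u : form (c *: u) w = c * form u w.
Proof. by rewrite -[c *: u]addr0 form_linl form0l addr0. Qed.
Lemma form_sumr w (T : Type) (r : seq T) (P : pred T) (F : T -> V) :
  form w (\sum_(t <- r | P t) F t) = \sum_(t <- r | P t) form w (F t).
Proof. exact: (big_morph (form w) (formDr w) (form0r w)). Qed.

Lemma form_col m i j : symplectic m -> form (col i m) (col j m) = gram K n i j.
Proof. by case=> _ mP; rewrite !colE mP form_delta. Qed.

Lemma symplectic_of_cols m :
  (forall i j, form (col i m) (col j m) = gram K n i j) -> symplectic m.
Proof.
move=> mP; have e : m^T *m gram K n *m m = gram K n.
  apply/matrixP => i j; rewrite -mP /form.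
  rewrite tr_col -row_mul [LHS]mxE [RHS]mxE; apply: eq_bigr => k _.
  by congr (_ * _); rewrite [RHS]mxE.
split=> [|u v].
  have := gram_unitmx; rewrite -{1}e unitmx_mul => /andP[_].
  by [].
by rewrite /form trmx_mul -!mulmxA (mulmxA (gram K n)) (mulmxA m^T) mulmxA (mulmxA m^T) e mulmxA.
Qed.

Lemma sum_cols m x : m \in unitmx ->
  x = \sum_i (invmx m *m x) i 0 *: col i m.
Proof.
move=> mU; rewrite -{1}(mulKVmx mU x); move: (invmx m *m x) => c.
apply/colP => k; rewrite mxE summxE; apply: eq_bigr => i _.
by rewrite !mxE mulrC.
Qed.

Lemma column_spanS m I J : I \subset J -> (column_span m I <= column_span m J)%VS.
Proof.
move=> /subsetP IJ; apply/span_subvP => _ /mapP[i + ->]; rewrite mem_enum => /IJ iJ.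
by apply: memv_span; apply: map_f; rewrite mem_enum.
Qed.

Lemma memv_col m I i : i \in I -> col i m \in column_span m I.
Proof. by move=> iI; apply: memv_span; apply: map_f; rewrite mem_enum. Qed.

Lemma column_spanP m I W :
  reflect (forall i, i \in I -> col i m \in W) (column_span m I <= W)%VS.
Proof.
apply: (iffP span_subvP) => h i.
  by move=> iI; apply: h; apply: map_f; rewrite mem_enum.
by move=> /mapP[j + ->]; rewrite mem_enum; apply: h.
Qed.

Lemma column_span0 m : column_span m set0 = 0%VS.
Proof. by rewrite /column_span enum_set0 span_nil. Qed.

Lemma dim_column_span m I : m \in unitmx -> \dim (column_span m I) = #|I|.
Proof.
move=> mU; have le J : (\dim (column_span m J) <= #|J|)%N.
  by apply: leq_trans (dim_span _) _; rewrite size_map -cardE.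
apply/eqP; rewrite eqn_leq le /=.
have full : (column_span m I + column_span m (~: I) = fullv)%VS.
  apply/eqP; rewrite eqEsubv subvf; apply/subvP => x _; rewrite (sum_cols x mU).
  rewrite (bigID (mem I)) /= memv_add // memv_suml // => i iI; apply: memvZ.
    exact: memv_col.
  by apply: memv_col; rewrite inE.
have := dimv_add_leqif (column_span m I) (column_span m (~: I)) => -[+ _].
rewrite full dimvf dim_matrix [X in (X <= _)%N](muln1 n.*2) => h.
rewrite -(leq_add2r #|~: I|) cardsC card_ord; apply: leq_trans h _.
by rewrite leq_add2l.
Qed.

Lemma symplectic_coord m x i : symplectic m ->
  (invmx m *m x) i 0 = form (col (bar i) m) x * gram K n (bar i) i.
Proof.
move=> mS; have [mU _] := mS; rewrite {2}(sum_cols x mU) form_sumr.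
rewrite (bigD1 i) //= big1 => [|k ki]; last first.
  by rewrite formZr form_col // gram_neq ?mulr0 // barK.
have := gram_bar_sq (bar i); rewrite barK => e.
by rewrite formZr form_col // addr0 -mulrA e mulr1.
Qed.

(** The coordinate of [x] along the column [i] is, up to sign, its pairing with
the column [bar i]. *)
Lemma mem_column_span_form m J x : symplectic m ->
  (forall j, bar j \notin J -> form (col j m) x = 0) -> x \in column_span m J.
Proof.
move=> mS hx; have [mU _] := mS; rewrite (sum_cols x mU) memv_suml // => i _.
have [iJ|iJ] := boolP (i \in J); first by rewrite memvZ // memv_col.
by rewrite symplectic_coord // hx ?barK // mul0r scale0r mem0v.
Qed.

(** The rows of a basis matrix B satisfy B G B^T = 0, where both factors B G and
B^T have rank equal to the dimension, so twice the dimension is at most 2n. *)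
Lemma isotropic_dim U : isotropic_space U -> (\dim U <= n)%N.
Proof.
move=> Uiso; pose B := \matrix_(i < \dim U, j < n.*2) (vbasis U)`_i j (0 : 'I_1).
have e : B *m gram K n *m B^T = 0.
  apply/matrixP => i j; rewrite mxE.
  transitivity (form (vbasis U)`_i (vbasis U)`_j); last first.
    by rewrite Uiso ?mxE // vbasis_mem // mem_nth // size_tuple.
  rewrite /form mxE; apply: eq_bigr => k _; rewrite !mxE; congr (_ * _).
  by apply: eq_bigr => l _; rewrite !mxE.
have Bfree : row_free B.
  apply: inj_row_free => v /rowP vB.
  have /freeP h := basis_free (vbasisP U).
  apply/rowP => i; rewrite mxE; apply: (h (fun k => v 0 k)); apply/colP => j.
  rewrite summxE.
  transitivity ((v *m B) 0 j); last by rewrite vB !mxE.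
  by rewrite mxE; apply: eq_bigr => k _; rewrite !mxE.
have := mulmx0_rank_max e; rewrite mxrankMfree ?row_free_unit ?gram_unitmx //.
by rewrite mxrank_tr; move: Bfree; rewrite -row_leq_rank; lia.
Qed.

Lemma isotropic_add_line U e : isotropic_space U ->
  {in U, forall u, form e u = 0} -> isotropic_space (U + <[e]>)%VS.
Proof.
move=> Uiso eU x y /memv_addP[u uU [_ /vlineP[c ->] ->]].
move=> /memv_addP[v vU [_ /vlineP[d ->] ->]].
rewrite formDl !formDr !formZl !formZr (Uiso u v) // [form u e]form_skew.
by rewrite (eU u) // (eU v) // form_alternating oppr0 !mulr0 !addr0.
Qed.

Lemma dim_add_line U e : e \notin U -> \dim (U + <[e]>)%VS = (\dim U).+1.
Proof.
move=> eU; rewrite dimv_disjoint_sum ?dim_vline.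
  by rewrite (memPnC eU) ?mem0v // addn1.
apply/eqP; rewrite -subv0; apply/subvP => x /memv_capP[xU /vlineP[c e1]].
rewrite memv0 e1; have [->|c0] := eqVneq c 0; first by rewrite scale0r.
by case/negP: eU; rewrite -(scalerK c0 e) -e1 memvZ.
Qed.

(** The Eichler transvection attached to an isotropic [v] and a vector [a]
orthogonal to [v]: it fixes [v], moves the vectors orthogonal to [v] along [v]
only, and [c] adjusts it by a symplectic transvection along [v]. *)
Definition transvection v a (c : K) x : V :=
  x + form x v *: a + form x a *: v + (c * form x v) *: v.

Lemma form_transvection v a c x y : form a v = 0 ->
  form (transvection v a c x) (transvection v a c y) = form x y.
Proof.
move=> av; rewrite /transvection !(formDl, formDr, formZl, formZr).
rewrite !form_alternating av [form v a]form_skew av.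
rewrite [form v y]form_skew [form a y]form_skew.
by rewrite !oppr0 !mulr0; ring.
Qed.

Definition covers U W : bool :=
  [&& (U <= W)%VS, \dim W == (\dim U).+1 & `[< isotropic_space W >] ].

Lemma coversP U W : reflect
  [/\ (U <= W)%VS, \dim W = (\dim U).+1 & isotropic_space W] (covers U W).
Proof.
apply: (iffP and3P) => [[h1 /eqP h2 /asboolP h3]|[h1 h2 h3]]; split=> //.
  exact/eqP.
exact/asboolP.
Qed.

(** An isotropic space has dimension at most n, which leaves no room for a jump
of more than one dimension in a flag of this length. *)
Lemma path_covers U s : \dim U + size s = n ->
  all (fun W => `[< isotropic_space W >]) s ->
  path (fun U W => (U <= W)%VS && (U != W)) U s -> path covers U s.
Proof.
pose lt := fun U W : {vspace V} => (U <= W)%VS && (U != W).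
have dim_path U0 s0 : isotropic_space U0 -> all (fun W => `[< isotropic_space W >]) s0 ->
    path lt U0 s0 -> (\dim U0 + size s0 <= n)%N.
  elim: s0 U0 => [|W s0 IH] U0 /= U0iso; first by rewrite addn0 => _ _; apply: isotropic_dim.
  move=> /andP[/asboolP Wiso siso] /andP[/andP[UW neq] p].
  have := IH W Wiso siso p; have [+ e] := dimv_leqif_eq UW.
  by rewrite leq_eqVlt e (negPf neq) /=; lia.
elim: s U => [|W s IH] U //= dU /andP[/asboolP Wiso siso] /andP[/andP[UW neq] p].
have d := dim_path _ _ Wiso siso p.
have [+ e] := dimv_leqif_eq UW; rewrite leq_eqVlt e (negPf neq) /= => d2.
have dW : \dim W = (\dim U).+1 by lia.
by rewrite IH ?andbT //; [apply/coversP | rewrite dW; lia].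
Qed.

End SymplecticBases.

(** * Integers and Euclidean descent on symplectic bases *)

Section IntegralSymplecticBases.
Variables (K : fieldExtType rat) (N : K -> nat) (n : nat).
Hypothesis N_eucl : multiplicative_euclidean_norm N.
Local Notation V := 'cV[K]_n.*2.
Implicit Types (u v w x y a : V) (m : 'M[K]_n.*2) (U W : {vspace V}).
Implicit Types (i j k : 'I_n.*2) (I J : {set 'I_n.*2}).

Lemma integerD (x y : K) : integer x -> integer y -> integer (x + y).
Proof. exact: integral_add. Qed.
Lemma integerM (x y : K) : integer x -> integer y -> integer (x * y).
Proof. exact: integral_mul. Qed.
Lemma integerN (x : K) : integer x -> integer (- x).
Proof. exact: integral_opp. Qed.
Lemma integer0 : integer (0 : K). Proof. exact: integral0. Qed.
Lemma integer1 : integer (1 : K). Proof. exact: integral1. Qed.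
Lemma integerz (z : int) : integer (z%:~R : K). Proof. exact: integral_id. Qed.
Lemma integer_sum (T : Type) (r : seq T) (P : pred T) (F : T -> K) :
  (forall t, P t -> integer (F t)) -> integer (\sum_(t <- r | P t) F t).
Proof. by apply: big_ind; [exact: integer0 | exact: integerD]. Qed.

Lemma intr_fieldext_eq0 (z : int) : (z%:~R == 0 :> K) = (z == 0).
Proof. by rewrite -(rmorph_int (in_alg K)) fmorph_eq0 intr_eq0. Qed.

(** If c is the leading coefficient of an integer polynomial of degree d with root
x, then c^(d - 1) times this polynomial is monic in c x. *)
Lemma integer_multiple (x : K) : exists2 d : int, d != 0 & integer (d%:~R * x).
Proof.
have [p mon_p px] := alg_integral (F := rat) x.
have [q [a a0 pq]] := rat_poly_scale p.
have q0 : q != 0.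
  by apply: contraTneq mon_p => q0; rewrite pq q0 rmorph0 scaler0 monicE lead_coef0.
have qx : root (map_poly (intr : int -> K) q) x.
  move: px; rewrite pq map_polyZ rootE hornerZ mulf_eq0 fmorph_eq0 invr_eq0.
  rewrite intr_eq0 (negPf a0) /= -map_poly_comp.
  by congr (_.[x] == 0); apply: eq_map_poly => z /=; rewrite -(rmorph_int (in_alg K)).
have c0 : lead_coef q != 0 by rewrite lead_coef_eq0.
exists (lead_coef q) => //; set c := lead_coef q.
case e : (size q) => [|[|d]].
- by move/eqP: e; rewrite size_poly_eq0 (negPf q0).
- move: qx; rewrite rootE [map_poly _ _]size1_polyC; last first.
    by apply: leq_trans (size_poly _ _) _; rewrite e.
  rewrite coef_map hornerC /= intr_fieldext_eq0.
  by move: c0; rewrite lead_coefE e => /negPf ->.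
pose Q := \poly_(i < d.+2) (if i == d.+1 then 1 else q`_i * c ^+ (d - i)).
have Qsz : size Q = d.+2 by rewrite size_poly_eq //= eqxx.
exists Q; first by rewrite monicE lead_coefE Qsz coef_poly ltnSn eqxx.
rewrite rootE (@horner_coef_wide _ d.+2); last first.
  by apply: leq_trans (size_poly _ _) _; rewrite Qsz.
suff -> : \sum_(i < d.+2) (map_poly intr Q)`_i * (c%:~R * x) ^+ i
    = c%:~R ^+ d * (map_poly (intr : int -> K) q).[x].
  by move/rootP: qx => ->; rewrite mulr0.
rewrite (@horner_coef_wide _ d.+2); last first.
  by apply: leq_trans (size_poly _ _) _; rewrite e.
rewrite mulr_sumr; apply: eq_bigr => i _; rewrite !coef_map coef_poly ltn_ord /=.
rewrite exprMn; have [->|ne] := eqVneq (i : nat) d.+1.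
  by rewrite -/c /c lead_coefE e /= rmorph1 mul1r exprSr !mulrA.
have id : (i <= d)%N by have := ltn_ord i; lia.
rewrite rmorphM rmorphXn /= -[X in _ = _ ^+ X * _](subnK id) exprD.
ring.
Qed.

Definition integer_vec v := forall k, integer (v k 0).

Lemma integer_vec_multiple v : exists2 c : K, c != 0 & integer_vec (c *: v).
Proof.
have /boolp.choice[d hd] : forall k, exists d : int, d != 0 /\ integer (d%:~R * v k 0).
  by move=> k; have [d] := integer_multiple (v k 0); exists d.
exists (\prod_k (d k)%:~R).
  by rewrite prodf_seq_neq0; apply/allP => k _; rewrite intr_fieldext_eq0; case: (hd k).
move=> k; rewrite mxE (bigD1 k) //= mulrAC; apply: integerM; first by case: (hd k).
by apply: big_ind => [||l _]; [exact: integer1 | exact: integerM | exact: integerz].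
Qed.

Lemma integer_vecD u v : integer_vec u -> integer_vec v -> integer_vec (u + v).
Proof. by move=> hu hv k; rewrite mxE; apply: integerD. Qed.
Lemma integer_vecZ (c : K) v : integer c -> integer_vec v -> integer_vec (c *: v).
Proof. by move=> hc hv k; rewrite mxE; apply: integerM. Qed.

Lemma integer_gram i j : integer (gram K n i j).
Proof.
rewrite mxE; case: ifP => _; last exact: integer0.
by case: ifP => _; [exact: integer1 | apply/integerN/integer1].
Qed.

Lemma integer_form u v : integer_vec u -> integer_vec v -> integer (form u v).
Proof.
move=> hu hv; rewrite formE; apply: integer_sum => i _.
by apply: integerM => //; apply: integerM => //; apply: integer_gram.
Qed.

(** The columns form a symplectic basis of the lattice of integer vectors; the
inverse matrix is integral because it is the adjoint for the form
([integer_invmx]). *)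
Definition integral_basis m := symplectic m /\ integer_mx m.

Lemma integer_col m i : integral_basis m -> integer_vec (col i m).
Proof. by case=> _ mZ k; rewrite mxE. Qed.

Lemma integer_invmx m : integral_basis m -> integer_mx (invmx m).
Proof.
move=> mB i j; have [mS _] := mB.
have -> : invmx m i j = (invmx m *m col j 1%:M) i 0.
  by rewrite colE mul1mx -colE mxE.
rewrite symplectic_coord //; apply: integerM (integer_gram _ _).
apply: integer_form; first exact: integer_col.
by move=> k; rewrite !mxE; case: eqP => _; [exact: integer1 | exact: integer0].
Qed.

Lemma euclidean_reduce (x b : K) : integer x -> integer b -> b != 0 ->
  exists2 q, integer q & (N (x + q * b) < N b)%N.
Proof.
case: N_eucl => _ _ hN hx hb b0; have [q [r [hq hr -> lt]]] := hN _ _ hx hb b0.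
by exists (- q); [apply: integerN | rewrite mulNr addrAC subrr add0r].
Qed.

(** The vector [a] is chosen so that the transvection adds to each column j, apart
from the columns i and bar i, the multiple q_j of column i prescribed by Euclidean
division of the pairings with [w].  The column bar i is thereby modified by [a],
and is reduced afterwards with the parameter [c].  The spans of isotropic sets
containing i are unchanged, as they avoid bar i. *)
Lemma transvection_descent m I i w : integral_basis m -> i \in free_indices I ->
    integer_vec w -> form w (col i m) != 0 ->
  exists m', [/\ integral_basis m', {in i |: I, forall j, col j m' = col j m},
    forall J, i \in J -> polar_free J -> column_span m' J = column_span m J
    & {in free_indices I, forall j, j != i ->
        (N (form w (col j m')) < N (form w (col i m)))%N}].
Proof.
move=> mB iI wZ fi0; have [mS mZ] := mB; set f := form w; set v := col i m.
have fZ j : integer (f (col j m)) by apply: integer_form => //; apply: integer_col.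
have /boolp.choice[q hq] : forall j, exists q,
    integer q /\ (N (f (col j m) + q * f v) < N (f v))%N.
  by move=> j; have [q] := euclidean_reduce (fZ j) (fZ i) fi0; exists q.
pose D := free_indices (i |: I).
pose a := \sum_(k in D) (q (bar k) * gram K n (bar k) k) *: col k m.
have aZ : integer_vec a.
  move=> r; rewrite summxE; apply: integer_sum => k _; rewrite mxE.
  apply: integerM; last by rewrite mxE.
  by apply: integerM (integer_gram _ _); case: (hq (bar k)).
have colDa j : j \in D -> form (col j m) a = q j.
  move=> jD; rewrite form_sumr (bigD1 (bar j)) ?free_bar //= big1 => [|k /andP[_ kj]].
    by rewrite formZr form_col // barK addr0 -mulrA gram_bar_sq mulr1.
  by rewrite formZr form_col // [gram K n j k]gram_neq ?mulr0.
have cola j : j \notin D -> form (col j m) a = 0.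
  move=> jD; rewrite form_sumr big1 // => k kD; rewrite formZr form_col //.
  rewrite [gram K n j k]gram_neq ?mulr0 //.
  by apply: contraNneq jD => e; rewrite -free_bar -e.
have iD : i \notin D by rewrite free_indicesU eqxx andbF.
have biD : bar i \notin D by rewrite free_bar.
pose g := gram K n (bar i) i.
have gg : g * g = 1 by have := gram_bar_sq K (bar i); rewrite barK.
(* The pairing with the column bar i after the shift by a, reduced last. *)
have [q0 q0Z hq0] := @euclidean_reduce (f (col (bar i) m + g *: a)) (f v)
   (integer_form wZ (integer_vecD (integer_col _ mB) (integer_vecZ (integer_gram _ _) aZ)))
   (fZ i) fi0.
pose c := q0 * g; pose T := transvection v a c.
have av : form a v = 0 by rewrite form_skew cola // oppr0.
have vZ : integer_vec v by apply: integer_col.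
have colv j : j != bar i -> form (col j m) v = 0.
  move=> ji; rewrite form_col // gram_neq //.
  by apply: contraNneq ji => ->; rewrite barK.
have TE j : j != bar i -> T (col j m) = col j m + form (col j m) a *: v.
  by move=> ji; rewrite /T /transvection colv // mulr0 !scale0r !addr0.
have Tbi : T (col (bar i) m) = col (bar i) m + g *: a + q0 *: v.
  by rewrite /T /transvection cola // scale0r addr0 form_col // -mulrA gg mulr1.
pose m' := \matrix_(r, k) T (col k m) r (0 : 'I_1).
have colm' k : col k m' = T (col k m) by apply/colP => r; rewrite !mxE.
have m'S : symplectic m'.
  by apply: symplectic_of_cols => j k; rewrite !colm' form_transvection // form_col.
have m'B : integral_basis m'.
  split=> // r k; rewrite mxE /T /transvection.
  have kZ := integer_col k mB.
  apply: integer_vecD r; first apply: integer_vecD; first apply: integer_vecD => //.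
  - by apply: integer_vecZ => //; apply: integer_form.
  - by apply: integer_vecZ => //; apply: integer_form.
  apply: integer_vecZ => //; apply: integerM; last exact: integer_form.
  by apply: integerM (integer_gram _ _).
exists m'; split=> //.
- move=> j jI; rewrite colm' TE; last first.
    apply: contraTneq jI => ->; rewrite !inE (negPf (bar_neq i)).
    by move: iI; rewrite inE => /andP[].
  rewrite cola ?scale0r ?addr0 // !inE; move: jI; rewrite !inE.
  by case/orP => ->; rewrite ?orbT.
- move=> J iJ /polar_freeP Jfree; apply/eqP; rewrite eqEdim.
  rewrite !dim_column_span ?(proj1 mS) ?(proj1 m'S) //.
  rewrite leqnn andbT; apply/column_spanP => j jJ; rewrite colm' TE.
    by apply: memvD; [|apply: memvZ]; apply: memv_col.
  by apply: contraNneq (Jfree i iJ) => <-.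
move=> j jI ji; rewrite colm'; have [->|jbi] := eqVneq j (bar i).
  by rewrite Tbi {1}/f formDr formZr.
rewrite TE // {1}/f formDr formZr colDa; first by case: (hq j).
by rewrite free_indicesU jI ji.
Qed.

End IntegralSymplecticBases.

(** * Cycles in the link of an isotropic space *)

Section LinkCycles.
Variables (K : fieldType) (n : nat).
Local Notation V := 'cV[K]_n.*2.
Implicit Types (e w x y : V) (U W L : {vspace V}).

(** The flags of length [r] in the link of [U] that climb one dimension at each
step; when [r] is the codimension of [U] in a Lagrangian space these are the
maximal flags. *)
Definition link_flag U r s := path (@covers K n) U s /\ size s = r.

Lemma link_flag_cons U L r s :
  link_flag U r.+1 (L :: s) <-> covers U L /\ link_flag L r s.
Proof.
rewrite /link_flag /=; split; first by case=> /andP[-> ->] [->].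
by case=> -> [-> ->].
Qed.

Lemma lowest_vertices_covers U r z L : supported (link_flag U r.+1) z ->
  L \in lowest_vertices z -> covers U L.
Proof. by move=> hz /lowest_vertices_mem[s /hz /link_flag_cons[]]. Qed.

Lemma link_part_flag U r z L : supported (link_flag U r.+1) z ->
  supported (link_flag L r) (link_part L z).
Proof.
by move=> hz s; rewrite coeff_link_part => /hz /link_flag_cons[].
Qed.

(** Two spaces that can be lowest in flags of [z] have the same dimension, so one
is never above the other, and the formula for the boundary of a link collapses. *)
Lemma link_part_cycle U r z : supported (link_flag U r.+1) z -> boundary z = 0 ->
  \sum_(L <- lowest_vertices z) link_part L z = 0 /\
  forall L, L \in lowest_vertices z -> boundary (link_part L z) = 0.
Proof.
move=> hz z0; have hz' : supported (fun s => size s = r.+1) z.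
  by apply: supported_sub hz => s [].
have cyc L : L \in lowest_vertices z -> boundary (link_part L z) = 0.
  move=> Lz; rewrite (boundary_link_part hz') // big1_seq // => x /= xz.
  apply/eqP/freeg_eqP => s; rewrite coeff0 !coeff_link_part.
  apply/eqP; apply/negPn/negP => /hz [/= /and3P[+ + _] _].
  move=> /coversP[_ dx _] /coversP[_ dL _].
  by have /coversP[_ + _] := lowest_vertices_covers hz Lz; lia.
split=> //; rewrite (cycle_sum_link hz' z0) big1_seq // => x /= xz; rewrite cyc //; exact: raddf0.
Qed.

Definition orthogonal_space e U := {in U, forall x, form e x = 0}.

Lemma orthogonal_add e U W : orthogonal_space e U -> orthogonal_space e W ->
  orthogonal_space e (U + W)%VS.
Proof.
by move=> hU hW x /memv_addP[u uU [w wW ->]]; rewrite formDr hU // hW // addr0.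
Qed.

(** Induction on the codimension [r].  For [r = 0] the space U + <e> would be
isotropic of dimension n + 1.  Otherwise let L be a lowest space of [z] that does
not contain e.  A space W that covers L and is not orthogonal to e meets the
orthogonal of e exactly in L, so no other lowest space of [z] lies in W, and the
condition that the links sum to 0 removes the flags through L and W.  Hence the
induction applies to L.  Only L = U + <e> is left, and its link vanishes as the
sum of all links does. *)
Lemma cycle_orthogonal_eq0 e r U z : isotropic_space U -> orthogonal_space e U ->
    e \notin U -> (\dim U + r)%N = n ->
    supported (link_flag U r) z -> boundary z = 0 ->
    {in lowest_vertices z, forall L, orthogonal_space e L} -> z = 0.
Proof.
elim: r U z => [|r IH] U z Uiso Ue eU dU hz z0 vz.
  have := isotropic_dim (isotropic_add_line Uiso Ue).
  by rewrite dim_add_line //; lia.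
have [sum0 cyc] := link_part_cycle hz z0.
have hz' : supported (fun s => size s = r.+1) z.
  by apply: supported_sub hz => s [].
have link0 L : L \in lowest_vertices z -> e \notin L -> link_part L z = 0.
  move=> Lz eL; have /coversP[UL dL Liso] := lowest_vertices_covers hz Lz.
  apply: (IH L) => //; [exact: vz | by lia | exact: link_part_flag hz | exact: cyc |].
  move=> W /lowest_vertices_mem[s]; rewrite coeff_link_part => cLW.
  (* If W is not orthogonal to e, then L is the only lowest space of z below W. *)
  apply: contrapT => Wperp; case/eqP: (cLW).
  apply: (coeff_sum_link_eq0 Lz sum0) => x xz xL.
  apply/eqP; apply/negPn/negP => cx; apply: Wperp.
  have [/= /and3P[_ /coversP[LW dW _] _] _] := hz _ cLW.
  have [/= /and3P[_ /coversP[xW dW' _] _] _] := hz _ cx.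
  suff -> : W = (x + L)%VS by apply: orthogonal_add; apply: vz.
  apply/esym/eqP; rewrite eqEdim subv_add xW LW /= dW.
  rewrite ltn_neqAle dimvS ?addvSr // andbT.
  have [_ ->] := dimv_leqif_eq (addvSr x L).
  apply: contra xL => /eqP Lx; rewrite eqEdim Lx addvSl -Lx.
  by rewrite -ltnS -dW dW' ltnS leqnn.
have all0 L : L \in lowest_vertices z -> link_part L z = 0.
  move=> Lz; have [eL|] := boolP (e \in L); last exact: link0.
  have LE (x : {vspace V}) : x \in lowest_vertices z -> e \in x -> x = (U + <[e]>)%VS.
    move=> xz ex; have /coversP[Ux dx _] := lowest_vertices_covers hz xz.
    by apply/esym/eqP; rewrite eqEdim subv_add Ux -memvE ex dim_add_line // dx /=.
  rewrite -[RHS]sum0 (bigD1_seq L) ?undup_uniq //= big1_seq ?addr0 // => x /andP[xL xz].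
  by apply: link0 => //; apply: contra xL => ex; rewrite (LE x) // (LE L).
by rewrite (join_link_decomp hz') big1_seq // => L /= Lz; rewrite all0 // raddf0.
Qed.

End LinkCycles.

(** * Integral apartments span the cycles of a link *)

Section IntegralApartments.
Variables (K : fieldExtType rat) (N : K -> nat) (n : nat).
Hypothesis N_eucl : multiplicative_euclidean_norm N.
Local Notation V := 'cV[K]_n.*2.
Implicit Types (e w : V) (m : 'M[K]_n.*2) (U W L : {vspace V}).
Implicit Types (i j p : 'I_n.*2) (I J : {set 'I_n.*2}).

Lemma orthogonal_column_span e m I :
  {in I, forall i, form e (col i m) = 0} -> orthogonal_space e (column_span m I).
Proof.
move=> h; apply: span_sub => [|c u v hu hv|_ /mapP[i + ->]].
- exact: form0r.
- by rewrite form_linr hu hv mulr0 addr0.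
by rewrite mem_enum; apply: h.
Qed.

Lemma isotropic_setU1 I i : polar_free I -> i \in free_indices I ->
  isotropic_set (i |: I).
Proof.
move=> hI iI; rewrite isotropic_setE polar_freeU // andbT.
by apply/set0Pn; exists i; rewrite setU11.
Qed.

Lemma card_freeU I i : i \in free_indices I -> #|i |: I| = #|I|.+1.
Proof. by rewrite inE cardsU1 => /andP[-> _]. Qed.

Lemma column_span_iso m I : symplectic m -> polar_free I ->
  isotropic_space (column_span m I).
Proof.
move=> mS hI; have [->|I0] := eqVneq I set0.
  rewrite column_span0 => u v; rewrite memv0 => /eqP -> _; exact: form0l.
by apply: column_span_isotropic => //; rewrite isotropic_setE I0.
Qed.

Lemma covers_column_span m I i : symplectic m -> polar_free I ->
  i \in free_indices I -> covers (column_span m I) (column_span m (i |: I)).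
Proof.
move=> mS hI iI; have [mU _] := mS; apply/coversP; split.
- by apply: column_spanS; apply: subsetUr.
- by rewrite !dim_column_span // card_freeU.
- by apply: column_span_iso => //; apply: polar_freeU.
Qed.

Lemma eq_column_span m m' I : {in I, forall i, col i m' = col i m} ->
  column_span m' I = column_span m I.
Proof.
by move=> h; congr <<_>>%VS; apply/eq_in_map => i; rewrite mem_enum; apply: h.
Qed.

(** The Euclidean algorithm on the pairings of [w] with the basis: as long as
another pairing is nonzero after a descent, it has smaller norm and serves as the
next pivot. *)
Lemma isolate_pairing m I w p : integral_basis m -> integer_vec w ->
    p \in free_indices I -> form w (col p m) != 0 ->
  exists m' p', [/\ integral_basis m', {in I, forall i, col i m' = col i m},
    p' \in free_indices I
    & {in free_indices I, forall j, j != p' -> form w (col j m') = 0}].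
Proof.
move=> + wZ; have [t] := ubnP (N (form w (col p m))).
elim: t => // t IH in m p * => lt mB pI fp0.
have [m' [m'B m'I _ m'N]] := transvection_descent N_eucl mB pI wZ fp0.
have m'm : {in I, forall i, col i m' = col i m}.
  by move=> i iI; apply: m'I; rewrite inE iI orbT.
have [|nz] := boolP [forall j in free_indices I, (j != p) ==> (form w (col j m') == 0)].
  move=> /forall_inP h; exists m', p; split=> // j jI jp.
  by apply/eqP; move/implyP: (h j jI); apply.
have /forall_inPn[j jI] := nz; rewrite negb_imply => /andP[jp fj0].
have ltj : (N (form w (col j m')) < t)%N.
  by rewrite (leq_trans (m'N j jI jp)) // -ltnS.
have [m2 [p2 [m2B m2I p2I h2]]] := IH m' j ltj m'B jI fj0.
by exists m2, p2; split=> // i iI; rewrite m2I // m'm.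
Qed.

(** Pick an integer vector [w] of L outside U and make it pair with a single free
column q; then [w] lies on the line of the column bar q modulo U. *)
Lemma covers_integral_basis m I L : integral_basis m -> polar_free I ->
    covers (column_span m I) L ->
  exists m' i, [/\ integral_basis m', {in I, forall j, col j m' = col j m},
    i \in free_indices I & L = column_span m' (i |: I)].
Proof.
move=> mB hI /coversP[UL dL Liso]; have [mS mZ] := mB.
have /subvPn[w0 w0L w0U] : ~~ (L <= column_span m I)%VS.
  by apply/negP => /dimvS; rewrite dL ltnn.
have [c c0 wZ] := integer_vec_multiple w0; set w := c *: w0 in wZ.
have wL : w \in L by apply: memvZ.
have wU : w \notin column_span m I.
  by apply: contra w0U => h; rewrite -(scalerK c0 w0) memvZ.
have wI i : i \in I -> form w (col i m) = 0.
  by move=> iI; apply: Liso => //; apply: (subvP UL); apply: memv_col.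
have free_or j : bar j \notin I -> j \in I \/ j \in free_indices I.
  by move=> bj; have [|jI] := boolP (j \in I); [left | right; rewrite inE jI].
have [p pI fp0] : exists2 p, p \in free_indices I & form w (col p m) != 0.
  apply: contrapT => none; case/negP: wU; apply: mem_column_span_form => // j bj.
  rewrite form_skew; apply/eqP; rewrite oppr_eq0; apply/negPn/negP => fj0.
  have [jI|jI] := free_or j bj; first by rewrite wI // eqxx in fj0.
  by apply: none; exists j.
have [m' [q [m'B m'I qI h]]] := isolate_pairing mB wZ pI fp0.
have [m'S m'Z] := m'B.
exists m', (bar q); split; rewrite ?free_bar //.
have wU' : w \in column_span m' (bar q |: I).
  apply: mem_column_span_form => // j; rewrite !inE negb_or => /andP[jq bj].
  rewrite form_skew; apply/eqP; rewrite oppr_eq0; apply/eqP.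
  have [jI|jI] := free_or j bj; first by rewrite m'I // wI.
  by apply: h => //; apply: contraNneq jq => ->.
have e : (column_span m I + <[w]>)%VS = L.
  by apply/eqP; rewrite eqEdim subv_add UL -memvE wL dim_add_line // dL /=.
have le : (L <= column_span m' (bar q |: I))%VS.
  rewrite -e subv_add -memvE wU' andbT -(eq_column_span m'I).
  by apply: column_spanS; apply: subsetUr.
apply/eqP; rewrite eqEdim le dL !dim_column_span ?(proj1 mS) ?(proj1 m'S) //.
by rewrite card_freeU ?free_bar /=.
Qed.

Definition apartment m r I := chain_map (column_span m) (cross_cycle r I).

Lemma chain_map_join (T T' : choiceType) (f : T -> T') x c :
  chain_map f (join_vertex x c) = join_vertex (f x) (chain_map f c).
Proof.
rewrite [c]freeg_decomp !raddf_sum; apply: eq_bigr => s _ /=.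
by rewrite join_vertexU !chain_mapU join_vertexU.
Qed.

Lemma apartment0 m I : apartment m 0 I = << [::] >>.
Proof. by rewrite /apartment /= chain_mapU. Qed.

Lemma apartmentS m r I : apartment m r.+1 I =
  \sum_(i in free_indices I)
    join_vertex (column_span m (i |: I)) (apartment m r (i |: I))
      *~ index_sign I i.
Proof.
rewrite /apartment /= raddf_sum; apply: eq_bigr => i _ /=.
by rewrite raddfMz /= chain_map_join.
Qed.

(** The flags of the apartment above [I] only involve the spans of the sets that
contain [I]. *)
Lemma eq_apartment m m' r I : polar_free I ->
  (forall J, I \subset J -> polar_free J -> column_span m' J = column_span m J) ->
  apartment m' r I = apartment m r I.
Proof.
elim: r I => [|r IH] I hI h; first by rewrite !apartment0.
rewrite !apartmentS; apply: eq_bigr => i iI; rewrite h ?subsetUr ?polar_freeU //.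
rewrite IH ?polar_freeU // => J iJ hJ; apply: h => //.
exact: subset_trans (subsetUr _ _) iJ.
Qed.

Lemma apartment_flag m r I : symplectic m -> polar_free I ->
  supported (link_flag (column_span m I) r) (apartment m r I).
Proof.
move=> mS; elim: r I => [|r IH] I hI.
  rewrite apartment0 => s; rewrite coeffU mul1r.
  by case: ([::] =P s) => [<- _|_] //; rewrite eqxx.
rewrite apartmentS; apply: supported_sum => i iI; apply: supportedMz.
apply: supported_join => s cs; apply/link_flag_cons; split.
  exact: covers_column_span.
by move: cs; apply: IH; apply: polar_freeU.
Qed.

Lemma boundary_apartment m r I : polar_free I -> (#|I| + r)%N = n ->
  boundary (apartment m r I) = 0.
Proof.
by move=> hI cI; rewrite chain_map_boundary boundary_cross_cycle // raddf0.
Qed.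

Definition apartment_over m r I a :=
  exists m', [/\ integral_basis m', {in I, forall i, col i m' = col i m}
    & a = apartment m' r I].

(** The measure of L relative to [e] is at most [t].  The norm of the pairing with
[e] is taken for some integral basis vector generating L, so that it never has to
be compared for two different generators. *)
Definition lower_vertex m I e t L := exists m' i,
  [/\ integral_basis m', {in I, forall j, col j m' = col j m},
      i \in free_indices I, L = column_span m' (i |: I)
    & (N (form e (col i m')) <= t)%N].

Definition lower_flag m I e r t s := link_flag (column_span m I) r.+1 s /\
  exists L s', s = L :: s' /\ lower_vertex m I e t L.

(** After the descent, the apartment of the new basis cancels the cone over [a],
and its other lowest spaces are generated by columns whose pairing with [e] has
smaller norm. *)
Lemma reduce_apartment m I e t r i m1 a : integer_vec e -> integral_basis m ->
    polar_free I -> (#|I| + r.+1)%N = n -> i \in free_indices I ->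
    {in I, forall j, col j m1 = col j m} ->
    form e (col i m1) != 0 -> (N (form e (col i m1)) <= t.+1)%N ->
    apartment_over m1 r (i |: I) a ->
  exists2 y, int_span (apartment_over m r.+1 I) y
    & supported (lower_flag m I e r t)
        (join_vertex (column_span m1 (i |: I)) a - y).
Proof.
move=> eZ mB hI cI iI m1I fi0 Nle [m2 [m2B m2I ->]].
have m2i : col i m2 = col i m1 by apply: m2I; rewrite setU11.
have fi0' : form e (col i m2) != 0 by rewrite m2i.
have [m3 [m3B m3I m3span m3N]] := transvection_descent N_eucl m2B iI eZ fi0'.
have m3m : {in I, forall j, col j m3 = col j m}.
  by move=> j jI; rewrite m3I ?m2I ?m1I // inE jI orbT.
have spanI : column_span m3 I = column_span m I by apply: eq_column_span.
have e1 : column_span m1 (i |: I) = column_span m3 (i |: I).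
  by rewrite (eq_column_span m3I) (eq_column_span m2I).
have hiI := polar_freeU hI iI.
have e2 : apartment m2 r (i |: I) = apartment m3 r (i |: I).
  apply/esym/eq_apartment => // J iJ hJ; apply: m3span => //.
  by apply: (subsetP iJ); rewrite setU11.
have [m3S _] := m3B.
exists (apartment m3 r.+1 I *~ index_sign I i).
  by apply: int_spanMz; apply: int_span_gen; exists m3.
rewrite apartmentS (bigD1 i) //= mulrzDl -mulrzA -expr2 /index_sign sqrr_sign.
rewrite e1 e2 mulr1z opprD addrA subrr add0r.
apply: supportedN; apply: supportedMz; apply: supported_sum => j /andP[jI ji].
apply: supportedMz; apply: supported_join => s cs; split.
  rewrite -spanI; apply/link_flag_cons; split; first exact: covers_column_span.
  by move: cs; apply: apartment_flag => //; apply: polar_freeU.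
exists (column_span m3 (j |: I)), s; split=> //; exists m3, j; split=> //.
by rewrite -ltnS; apply: leq_trans Nle; rewrite -m2i; apply: m3N.
Qed.

(** Induction on the codimension [r], and for given [r] on a bound [t] for the
measures of the lowest spaces of the cycle. *)
Lemma integral_apartments_span r m I z : polar_free I -> (#|I| + r)%N = n ->
    integral_basis m -> supported (link_flag (column_span m I) r) z ->
  boundary z = 0 -> int_span (apartment_over m r I) z.
Proof.
elim: r m I z => [|r IH] m I z hI cI mB hz z0.
  have -> : z = << [::] >> *~ coeff [::] z.
    apply/eqP/freeg_eqP => s; rewrite raddfMz /= coeffU mul1r.
    case: ([::] =P s) => [<-|ns]; first by rewrite -mulrzr intz mul1r.
    rewrite mul0rz; apply/eqP; apply/negPn/negP => /hz[_ /size0nil] s0.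
    by apply: ns.
  apply: int_spanMz; apply: int_span_gen; exists m; split=> //.
  by rewrite apartment0.
have [mS mZ] := mB; have [mU _] := mS.
(* Codimension left over means that some index is still free; e is its column. *)
have [j0 j0I] : exists j0, j0 \in free_indices I.
  apply/set0Pn; rewrite -card_gt0 card_free_indices // -doubleB double_gt0.
  by rewrite subn_gt0; move: cI; lia.
pose e := col j0 m; set U := column_span m I in hz *.
have eZ : integer_vec e by apply: integer_col.
have eU : e \notin U by rewrite mem_column_span //; move: j0I; rewrite inE => /andP[].
have Ue : orthogonal_space e U.
  apply: orthogonal_column_span => i iI; rewrite form_col // gram_neq //.
  by apply: contraTneq iI => ->; move: j0I; rewrite inE => /andP[].
have dU : (\dim U + r.+1)%N = n by rewrite dim_column_span.
have Uiso : isotropic_space U by apply: column_span_iso.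
have hz' z1 : supported (link_flag U r.+1) z1 -> supported (fun s => size s = r.+1) z1.
  by apply: supported_sub => s [].
have span_flag y : int_span (apartment_over m r.+1 I) y ->
    supported (link_flag U r.+1) y /\ boundary y = 0.
  elim=> [|k x y' [m' [m'B m'I ->]] _ [sy by0]].
    by split; [exact: supported0 | exact: raddf0].
  split; last by rewrite raddfD raddfMz /= boundary_apartment // by0 mul0rz addr0.
  apply: supportedD => //; apply: supportedMz; rewrite /U -(eq_column_span m'I).
  by case: m'B => m'S _; apply: apartment_flag.
suff main t z1 : supported (link_flag U r.+1) z1 -> boundary z1 = 0 ->
    {in lowest_vertices z1, forall L, lower_vertex m I e t L} ->
    int_span (apartment_over m r.+1 I) z1.
  have mono t t' L : (t <= t')%N -> lower_vertex m I e t L -> lower_vertex m I e t' L.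
    move=> tt' [m' [i [h1 h2 h3 h4 h5]]]; exists m', i; split=> //.
    exact: leq_trans h5 tt'.
  have [t ht] : exists t, {in lowest_vertices z, forall L, lower_vertex m I e t L}.
    have : {subset lowest_vertices z <= lowest_vertices z} by [].
    elim: {1 3}(lowest_vertices z) => [|L s IHs] sub; first by exists 0%N.
    have [|t ht] := IHs; first by move=> x xs; apply: sub; rewrite inE xs orbT.
    have cL := lowest_vertices_covers hz (sub L (mem_head _ _)).
    have [m' [i [h1 h2 h3 h4]]] := covers_integral_basis mB hI cL.
    exists (maxn t (N (form e (col i m')))) => x; rewrite inE => /orP[/eqP ->|xs].
      by exists m', i; split=> //; apply: leq_maxr.
    by apply: mono (ht x xs); apply: leq_maxl.
  exact: (main t).
elim: t z1 => [|t IHt] z1 hz1 z10 low.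
  have [N0 _ _] := N_eucl.
  suff -> : z1 = 0 by apply: int_span0.
  apply: (cycle_orthogonal_eq0 Uiso Ue eU dU hz1 z10) => L /low.
  move=> [m' [i [m'B m'I iI -> ]]]; rewrite leqn0 => /eqP.
  move=> /(N0 _ (integer_form eZ (integer_col i m'B))) f0.
  apply: orthogonal_column_span => j; rewrite !inE => /orP[/eqP -> //|jI].
  by rewrite m'I //; apply: Ue; apply: memv_col.
have [_ cyc] := link_part_cycle hz1 z10.
have reduce L : L \in lowest_vertices z1 ->
    exists2 y, int_span (apartment_over m r.+1 I) y
    & supported (lower_flag m I e r t) (join_vertex L (link_part L z1) - y).
  move=> Lz; have [m1 [i [m1B m1I iI eL Nle]]] := low L Lz.
  have [Nle'|Ngt] := leqP (N (form e (col i m1))) t.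
    exists 0; first exact: int_span0.
    rewrite subr0; apply: supported_join => s.
    rewrite coeff_link_part => /hz1 hs; split=> //.
    by exists L, s; split=> //; exists m1, i.
  have fi0 : form e (col i m1) != 0.
    apply: contraTneq Ngt => ->; have [N0 _ _] := N_eucl.
    by have /N0 [_ ->] := integer0 K.
  have : int_span (apartment_over m1 r (i |: I)) (link_part L z1).
    apply: IH => //; [exact: polar_freeU | by rewrite card_freeU // addSnnS | | exact: cyc].
    by rewrite -eL; apply: link_part_flag hz1.
  rewrite eL; elim=> [|k a z2 ha _ [y2 hy2 sy2]].
    exists 0; first exact: int_span0.
    by rewrite raddf0 subr0; apply: supported0.
  have [y hy sy] := reduce_apartment eZ mB hI cI iI m1I fi0 Nle ha.
  exists (y *~ k + y2); first by apply: int_spanD => //; apply: int_spanMz.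
  rewrite raddfD raddfMz /= opprD addrACA -mulrzBl.
  by apply: supportedD => //; apply: supportedMz.
have [y hy sy] : exists2 y, int_span (apartment_over m r.+1 I) y
    & supported (lower_flag m I e r t) (z1 - y).
  rewrite {1}(join_link_decomp (hz' z1 hz1)).
  have : {subset lowest_vertices z1 <= lowest_vertices z1} by [].
  elim: {1 3}(lowest_vertices z1) => [|L s IHs] sub.
    by exists 0; [exact: int_span0 | rewrite big_nil subr0; exact: supported0].
  have [|y2 hy2 sy2] := IHs; first by move=> x xs; apply: sub; rewrite inE xs orbT.
  have [y hy sy] := reduce L (sub L (mem_head _ _)).
  exists (y + y2); first exact: int_spanD.
  by rewrite big_cons opprD addrACA; apply: supportedD.
have [_ y0] := span_flag y hy.
rewrite -(subrK y z1); apply: int_spanD => //; apply: IHt.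
- by apply: supported_sub sy => s [].
- by rewrite raddfB /= z10 y0 subr0.
by move=> L /lowest_vertices_mem[s /sy[_ [L' [s' [[-> _]]]]]].
Qed.

End IntegralApartments.

(** * Passage to homology *)

Section HomologyClass.
Variables (T : choiceType) (F : pred (seq T)) (d : nat).

Lemma homology_classB (z1 z2 : cycle F d) :
  homology_class (z1 - z2) = homology_class z1 - homology_class z2.
Proof. exact: raddfB. Qed.

HB.instance Definition _ :=
  GRing.isZmodMorphism.Build _ _ (@homology_class T F d) homology_classB.

Lemma homology_class_surj (x : homology F d) : exists z, x = homology_class z.
Proof. by exists (repr x); rewrite /homology_class reprK. Qed.

End HomologyClass.

Section HomologyMap.
Variables (T T' : choiceType) (F : pred (seq T)) (F' : pred (seq T')) (d : nat).
Variables (f : T -> T') (fP : forall s, F s -> F' (map f s)).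

Lemma cycle_mapB (z1 z2 : cycle F d) :
  cycle_map fP (z1 - z2) = cycle_map fP z1 - cycle_map fP z2.
Proof. by apply/val_inj; rewrite /= !raddfB. Qed.

Lemma homology_mapB (x y : homology F d) :
  homology_map fP (x - y) = homology_map fP x - homology_map fP y.
Proof.
have [z1 ->] := homology_class_surj x; have [z2 ->] := homology_class_surj y.
by rewrite -raddfB !homology_map_class cycle_mapB raddfB.
Qed.

HB.instance Definition _ :=
  GRing.isZmodMorphism.Build _ _ (@homology_map T T' F F' f fP d) homology_mapB.

End HomologyMap.

Lemma cross_cycle_chain n r I s : @polar_free n I ->
  coeff s (cross_cycle r I) != 0 ->
  [/\ path (fun I J : {set 'I_n.*2} => I \proper J) I s, all (@isotropic_set n) s
    & size s = r].
Proof.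
elim: r I s => [|r IH] I s hI.
  by rewrite coeffU mul1r; case: ([::] =P s) => [<- _|_] //; rewrite eqxx.
move: s; apply: (@supported_sum _ (fun s => [/\ path _ I s, _ & _])) => i iI.
apply: supportedMz; apply: supported_join => s.
move=> /(IH _ _ (polar_freeU hI iI))[p a <-].
split=> //=; rewrite ?a ?p ?andbT.
  rewrite properE subsetUr; apply/subsetPn; exists i; rewrite ?setU11 //.
  by move: iI; rewrite inE => /andP[].
exact: isotropic_setU1.
Qed.

Lemma cross_cycle_cycle n : (0 < n)%N ->
  cross_cycle n set0 \in cycle_pred (@cross_polytope n) n.-1.
Proof.
move=> n0; rewrite inE boundary_cross_cycle ?polar_free0 ?cards0 // eqxx andbT.
apply/chainP => s /(cross_cycle_chain (polar_free0 n))[p a ->].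
split; last by rewrite prednK.
rewrite /cross_polytope /flag inE a /=; apply: (subseq_pairwise (suffix_subseq [:: set0] s)).
by rewrite -sorted_pairwise // => ? ? ?; apply: proper_trans.
Qed.

Lemma building_link_flag (K : fieldType) n s : @building K n s -> size s = n ->
  link_flag 0%VS n s.
Proof.
move=> /andP[/allP sV sP] sz; split=> //; apply: path_covers.
- by rewrite dimv0.
- by apply/allP => U /sV /andP[].
have := pairwise_sorted sP; case: s sV {sP sz} => //= U s sV ->.
by rewrite andbT sub0v eq_sym; have /andP[] := sV U (mem_head _ _).
Qed.

Lemma integral_basis1 (K : fieldExtType rat) n : integral_basis (1%:M : 'M[K]_n.*2).
Proof.
split; first by split=> [|u v]; rewrite ?unitmx1 ?mul1mx.
by move=> i j; rewrite mxE; case: eqP => _; [exact: integer1 | exact: integer0].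
Qed.

Theorem theorem4p11 (K : fieldExtType rat) (N : K -> nat) (n : nat)
    (N_eucl : multiplicative_euclidean_norm N) (n_gt0 : (0 < n)%N)
    (xi : homology (@cross_polytope n) n.-1) (xi_fund : fundamental_class xi)
    (H : zmodType) (h_ : {additive homology (@building K n) n.-1 -> H})
    (h_bij : bijective h_) :
  spans (fun x : H => exists2 m : Sp K n,
    in_SpO m & x = modular_symbol h_ xi m).
Proof.
set S := fun x => _; apply: int_span_spans => x.
have [h' _ hK] := h_bij; rewrite -[x]hK; move: (h' x) => {x}y.
pose zeta := Cycle (cross_cycle_cycle n_gt0).
have [k zetaE] := xi_fund (homology_class zeta).
have gen c : int_span (apartment_over (1%:M : 'M[K]_n.*2) n set0) c ->
    forall z : cycle (@building K n) n.-1, cycle_val z = c ->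
    int_span S (h_ (homology_class z)).
  elim=> [|l a c' [m [mB _ ->]] _ IH] z ec.
    have -> : z = 0 by apply: val_inj.
    by rewrite !raddf0; apply: int_span0.
  have [mS mZ] := mB; pose m_ : Sp K n := exist _ m mS.
  pose za := cycle_map (fun s => column_span_flag (s := s) (svalP m_)) zeta.
  have -> : z = za *~ l + (z - za *~ l) by rewrite addrC subrK.
  rewrite 2!raddfD; apply: int_spanD; last first.
    apply: IH.
    by rewrite -[LHS]/(val (z - za *~ l)) raddfB raddfMz /= ec addrAC subrr add0r.
  rewrite !raddfMz /=; apply: int_spanMz.
  rewrite -homology_map_class zetaE !raddfMz; apply: int_spanMz.
  apply: int_span_gen; exists m_ => //; split=> //; exact: integer_invmx.
have [z ->] := homology_class_surj y; apply: gen (erefl _).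
have /andP[zC /eqP z0] := cycleP z.
apply: (integral_apartments_span N_eucl) => //.
- exact: polar_free0.
- by rewrite cards0.
- exact: integral_basis1.
move=> s /(chainP _ _ _ zC)[bs ss]; rewrite column_span0.
by apply: building_link_flag; rewrite // ss prednK.
Qed.
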